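(* Suppose that $\underline{p}_u\le\bar{p}_u$ and $\underline{\chi}\le\bar{\chi}$ are such that, for all $\chi\in[\underline{\chi},\bar{\chi}]$, $[\underline{p}_u,\bar{p}_u]\subset(|\chi|\sqrt{R_sT},\,1/|\alpha|)$, and such that $p_v(p_u,\chi)\in(|\chi|\sqrt{R_sT},\,1/|\alpha|)$ for all $(p_u,\chi)\in[\underline{p}_u,\bar{p}_u]\times[\underline{\chi},\bar{\chi}]$. Let $\mathcal{F}=[p_u^-,p_u^+]\times[\chi^-,\chi^+]\subseteq[\underline{p}_u,\bar{p}_u]\times[\underline{\chi},\bar{\chi}]$ be a given nonempty box. Then the derivative $\partial_\chi p_v(p_u,\chi)\le0$ has the following properties: $$\min_{(p_u,\chi)\in\mathcal{F}\cap(\mathbb{R}\times\mathbb{R}_{\ge0})}\partial_\chi p_v(p_u,\chi)=\partial_\chi p_v(p_u^-,\chi^+)\quad\text{if }\chi^+\ge0,$$ $$\min_{(p_u,\chi)\in\mathcal{F}\cap(\mathbb{R}\times\mathbb{R}_{\le0})}\partial_\chi p_v(p_u,\chi)>\partial_\chi p_v\big(p_v(p_u^-,\chi^-),-\chi^-\big)\quad\text{if }\chi^-<0.$$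
   Context: Fix constants $R_s>0$, $T>0$, $\theta>0$, $\mathcal{L}>0$ (pipe length), and $\alpha<0$. For $\chi\in\mathbb{R}$ (mass flux) and $p\in(|\chi|\sqrt{R_sT},1/|\alpha|)$ let $$F(p)=F_\chi(p)=\frac1\alpha p+\left(\chi^2R_sT-\frac1{\alpha^2}\right)\ln(|1+\alpha p|)-\chi^2R_sT\ln(p),$$ which is strictly increasing in $p$ on this interval. The pressure function is $$p(x,p_u,\chi)=F_\chi^{-1}\left(F_\chi(p_u)-\tfrac12R_sT\,\chi|\chi|\,\theta x\right),\quad x\in[0,\mathcal{L}],$$ where $F_\chi^{-1}$ is the inverse of $F_\chi$ on $(|\chi|\sqrt{R_sT},1/|\alpha|)$, and the outlet pressure is $p_v(p_u,\chi)=p(\mathcal{L},p_u,\chi)$. The notation $\partial_\chi p_v(a,b)$ denotes the partial derivative of $p_v$ with respect to its second argument, evaluated at the point $(a,b)$; in particular $\partial_\chi p_v(p_v(p_u^-,\chi^-),-\chi^-)$ is this partial derivative evaluated at $(p_v(p_u^-,\chi^-),-\chi^-)$. *)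

(* Defs.v *)
From HB Require Import structures.
From mathcomp Require Import all_boot all_order all_algebra.
From mathcomp Require Import all_classical all_reals all_analysis.

Set Implicit Arguments.
Unset Strict Implicit.
Unset Printing Implicit Defensive.

Import Order.TTheory GRing.Theory Num.Theory.
Import numFieldNormedType.Exports.

Local Open Scope classical_set_scope.
Local Open Scope ring_scope.

Definition padm (R : realType) (Rs T alpha chi : R) : set R :=
  `](`|chi| * Num.sqrt (Rs * T)), (1 / `|alpha|)[.

Definition Ffun (R : realType) (Rs T alpha chi p : R) : R :=
  1 / alpha * p
  + (chi ^+ 2 * Rs * T - 1 / alpha ^+ 2) * ln `|1 + alpha * p|
  - chi ^+ 2 * Rs * T * ln p.

(* The inverse of [Ffun] on [padm]. Its value is 0 at a point that [Ffun] does
   not reach from [padm]. As [0] is never in [padm], a membership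
   [Finv _ _ _ chi y \in padm _ _ _ chi] says that [y] is really in the range. *)
Definition Finv (R : realType) (Rs T alpha chi : R) : R -> R :=
  'pinv_(fun=> 0) (padm Rs T alpha chi) (Ffun Rs T alpha chi).

Definition pressure (R : realType) (Rs T theta alpha x pu chi : R) : R :=
  Finv Rs T alpha chi
    (Ffun Rs T alpha chi pu - 1 / 2 * Rs * T * (chi * `|chi|) * theta * x).

Definition pv (R : realType) (Rs T theta L alpha pu chi : R) : R :=
  pressure Rs T theta alpha L pu chi.

Definition dchi_pv (R : realType) (Rs T theta L alpha a b : R) : R :=
  derive1 (pv Rs T theta L alpha a) b.

Definition is_minimum (R : realType) (A : set R) (m : R) : Prop :=
  A m /\ lbound A m.

(* Main.v *)
Require Import Defs.
From HB Require Import structures.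
From mathcomp Require Import all_boot all_order all_algebra.
From mathcomp Require Import all_classical all_reals all_analysis.
From mathcomp Require Import ring lra.
Set Implicit Arguments.
Unset Strict Implicit.
Unset Printing Implicit Defensive.

Import Order.TTheory GRing.Theory Num.Theory.
Import numFieldNormedType.Exports.
Local Open Scope classical_set_scope.
Local Open Scope ring_scope.

(** Write H p = ln (1 + alpha p) - ln p, s = chi^2 Rs T and k = theta L / 2.
Since F_chi is affine in s, it is Phi s p = Phi 0 p + s H p, and its derivative
factors as (p^2 - s) / (p (1 + alpha p)). In the admissible range this is
positive, and 1 + alpha p, the compressibility factor of the gas, lies in
]0, 1[. The outlet pressure q = p_v(p, chi) solves
Phi s q = Phi s p - k Rs T chi |chi|, so the gas flows from the higher
pressure hi to the lower one lo with Phi s hi = Phi s lo + k s: the inlet is hi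
for chi >= 0 and lo for chi <= 0. Reversing the pipe exchanges the two ends.

Differentiating the equation of q in chi, and noticing that H q - H p has the
sign of chi, gives for both signs of the flux the single formula
  d_chi p_v = - 2 Rs T |chi| (1 / Phi_s'(q)) (|H p - H q| + k),
a product of nonnegative factors (is_derive_pv), which proves the sign. The
extremal values then follow by comparing the factors one by one.

- 1 / Phi_s'(q) decreases in q and increases in s (inv_dPhi_le, inv_dPhi_lt).
- For a fixed flux, raising the pressures on the pipe raises both ends and
  shrinks the gap H lo - H hi (flow_gap). The reason is that
  H' = - Phi_s' / (p^2 - s): equal increments of Phi s yield smaller
  decrements of H at higher pressures.
- For a fixed end, a larger |chi| moves the other end away from it
  (flow_lo_decr, flow_hi_incr), which widens the gap.

For chi >= 0 all factors of the product are therefore largest at the lowest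
inlet pressure and the largest flux (slope_le_ge0). For chi <= 0 only the
dependence on p is monotone (slope_le_le0): the minimum over the box reduces to
that of a continuous function of chi on a segment, hence it is attained. It is
compared with the reversed pipe, in which the gas flows from p_v(pm, chim) to
pm with flux - chim: the gap is at least as wide, and the factor 1 / Phi_s' is
taken at the end pm, below the end q used in the box (slope_lt_rev). *)

(** * Two differentiation lemmas *)

(** If P (q y) - P (q x) is divisible by y - x with a quotient m continuous at
x, then so is q y - q x as soon as P' does not vanish at q x: divide by the
Caratheodory slope of P. The quotient m may depend on q itself, so that an
implicit equation whose other terms involve q is covered as well. *)
Lemma is_derive_implicit (R : realType) (P q m : R -> R) (x d : R) :
  is_derive (q x) 1 P d -> d != 0 ->
  {for x, continuous q} -> {for x, continuous m} ->
  (\forall y \near x, P (q y) - P (q x) = m y * (y - x)) ->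
  is_derive x 1 q (m x / d).
Proof.
move=> /is_derive1_caratheodory[g [Pg cg gd]] d0 cq cm Pq.
have cgq : {for x, continuous (g \o q)} by apply: continuous_comp.
have gq0 : \forall y \near x, g (q y) != 0.
  by apply: (cvgr_neq0 _ cgq); rewrite /= gd.
pose f y := q x + m y / g (q y) * (y - x).
have : is_derive x 1 f (m x / d).
  apply/is_derive1_caratheodory; exists (fun y => m y / g (q y)); split.
  - by move=> z; rewrite /f subrr mulr0 addr0 addrAC subrr add0r.
  - by apply: cvgM => //; apply: cvgV; rewrite //= gd.
  - by rewrite gd.
apply: near_eq_is_derive; near=> y.
have e : P (q y) - P (q x) = m y * (y - x) by near: y.
have g0 : g (q y) != 0 by near: y.
by rewrite /f mulrAC -e Pg mulrAC mulfV// mul1r addrC subrK.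
Unshelve. all: by end_near. Qed.

(** The friction term chi |chi| is differentiable also where the flow
reverses. *)
Lemma is_derive_mul_norm (R : realType) (x : R) :
  is_derive x 1 (fun y : R => y * `|y|) (2 * `|x|).
Proof.
have scaleE (a b : R) : a *: b = a * b by [].
have sq (y : R) : is_derive y 1 (fun z => z * z) (2 * y).
  have -> : (fun z : R => z * z) = (id : R -> R) * (id : R -> R) by [].
  apply: (is_derive_eq (is_deriveM (is_derive_id y 1) (is_derive_id y 1))).
  by rewrite !scaleE; ring.
have [x0|x0|->] := ltgtP x 0.
- rewrite ltr0_norm// mulrN.
  apply: (@near_eq_is_derive _ _ _ (- (fun z : R => z * z))).
    near=> y; rewrite /= ltr0_norm ?mulrN//; near: y; exact: lt_nbhsl.
- rewrite gtr0_norm//.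
  apply: (@near_eq_is_derive _ _ _ (fun z : R => z * z)) => //.
  near=> y; rewrite /= gtr0_norm//; near: y; exact: lt_nbhsr.
- rewrite normr0 mulr0; apply/is_derive1_caratheodory.
  exists (fun y => `|y|); split; rewrite ?normr0//.
  + by move=> z; rewrite mul0r !subr0 mulrC.
  + exact: norm_continuous.
Unshelve. all: by end_near. Qed.

(** * The potential and its monotonicity *)
Section Pipe.
Context {R : realType} (alpha : R) (alpha_lt0 : alpha < 0).
Implicit Types k s p q u v w hi lo : R.

Definition log_ratio p : R := ln (1 + alpha * p) - ln p.

(** F_chi with chi^2 Rs T replaced by a free real parameter s: comparing
different values of s at the same pressures is the main tool below. *)
Definition Phi s p : R :=
  p / alpha - ln (1 + alpha * p) / alpha ^+ 2 + s * log_ratio p.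

Lemma Phi_shift s s' p : Phi s' p = Phi s p + (s' - s) * log_ratio p.
Proof. by rewrite /Phi; ring. Qed.

Lemma is_derive_Phi s p : 0 < p -> 0 < 1 + alpha * p ->
  is_derive p 1 (Phi s) ((p ^+ 2 - s) / (p * (1 + alpha * p))).
Proof.
move=> p0 ap.
have scaleE (a b : R) : a *: b = a * b by [].
pose aff (x : R) := 1 + alpha * x.
have daff : is_derive p 1 aff alpha.
  have -> : aff = cst 1 + alpha \*: id by [].
  apply: is_derive_eq (is_deriveD (is_derive_cst _ _ _)
    (is_deriveZ _ (is_derive_id _ _))) _.
  by rewrite add0r scaleE mulr1.
have dln : is_derive p 1 (@ln R \o aff) ((1 + alpha * p)^-1 * alpha).
  by apply: is_derive1_comp; exact: is_derive1_ln.
have -> : Phi s = (alpha^-1 \*: (id : R -> R))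
   + (- alpha ^- 2) \*: (@ln R \o aff)
   + s \*: (@ln R \o aff - @ln R).
  by apply/funext => x; rewrite /Phi /log_ratio !fctE /= !scaleE /aff; ring.
apply: (is_derive_eq (is_deriveD (is_deriveD (is_deriveZ _ (is_derive_id _ _))
  (is_deriveZ _ dln)) (is_deriveZ s (is_deriveB dln (is_derive1_ln p0))))).
rewrite !scaleE.
by field; rewrite (gt_eqF p0) (gt_eqF ap) (lt_eqF alpha_lt0).
Qed.

Lemma compr_gt0 p q : p <= q -> 0 < 1 + alpha * q -> 0 < 1 + alpha * p.
Proof. by move=> pq /lt_le_trans; apply; rewrite lerD2l ler_nM2l. Qed.

Lemma subsonic_le s p q : 0 < p -> s < p ^+ 2 -> p <= q -> s < q ^+ 2.
Proof.
move=> p0 sp pq; apply: (lt_le_trans sp).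
by rewrite lerXn2r// nnegrE ltW// (lt_le_trans p0).
Qed.

Lemma log_ratio_decr p q :
  0 < p -> p <= q -> 0 < 1 + alpha * q -> log_ratio q <= log_ratio p.
Proof.
move=> p0 pq aq; have ap := compr_gt0 pq aq.
by rewrite lerB// ler_ln ?posrE ?lerD2l ?ler_nM2l// (lt_le_trans p0).
Qed.

Lemma Phi_mvt s p q : 0 < p -> p < q -> 0 < 1 + alpha * q ->
  exists2 w, p < w < q &
    Phi s q - Phi s p = (w ^+ 2 - s) / (w * (1 + alpha * w)) * (q - p).
Proof.
move=> p0 pq aq.
have dPhi x : x \in `[p, q]%R ->
    is_derive x 1 (Phi s) ((x ^+ 2 - s) / (x * (1 + alpha * x))).
  rewrite in_itv/= => /andP[px xq].
  by apply: is_derive_Phi; [exact: lt_le_trans px|exact: compr_gt0 aq].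
have [|w] := @MVT R (Phi s) _ p q pq
    (fun x xpq => dPhi x (subset_itv_oo_cc xpq)).
- by apply: derivable_within_continuous => x /dPhi[].
by rewrite in_itv/= => wpq ->; exists w.
Qed.

Lemma Phi_incr s p q : 0 < p -> s <= p ^+ 2 -> p < q -> 0 < 1 + alpha * q ->
  Phi s p < Phi s q.
Proof.
move=> p0 sp pq aq; have [w /andP[pw wq] e] := Phi_mvt s p0 pq aq.
have w0 := lt_trans p0 pw; have aw := compr_gt0 (ltW wq) aq.
rewrite -subr_gt0 e; apply: mulr_gt0; last by rewrite subr_gt0.
by rewrite divr_gt0 ?mulr_gt0// subr_gt0 (le_lt_trans sp)// ltrXn2r// ltW.
Qed.

Lemma Phi_le s p q : 0 < p -> s <= p ^+ 2 -> p <= q -> 0 < 1 + alpha * q ->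
  Phi s p <= Phi s q.
Proof.
move=> p0 sp; rewrite le_eqVlt => /predU1P[->//|pq] aq.
exact/ltW/Phi_incr.
Qed.

Lemma Phi_decr s p q : 0 < p -> q ^+ 2 <= s -> p <= q -> 0 < 1 + alpha * q ->
  Phi s q <= Phi s p.
Proof.
move=> p0 qs; rewrite le_eqVlt => /predU1P[->//|pq] aq.
have [w /andP[pw wq] e] := Phi_mvt s p0 pq aq.
have w0 := lt_trans p0 pw; have aw := compr_gt0 (ltW wq) aq.
rewrite -subr_le0 e; apply: mulr_le0_ge0; last by rewrite subr_ge0 ltW.
rewrite pmulr_lle0 ?invr_gt0 ?mulr_gt0// subr_le0 (le_trans _ qs)//.
by rewrite lerXn2r ?nnegrE ?(ltW w0) ?(ltW wq)// ltW// (lt_trans w0).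
Qed.

(** With M = u2^2 - s, the function Phi s + M * log_ratio is again of the form
Phi _, with critical point u2. Hence it decreases on [u1, u2] and increases on
[v1, v2], which compares the increments of Phi s with M times the decrements of
log_ratio, from above on the first interval and from below on the second. *)
Lemma log_ratio_gap s u1 u2 v1 v2 :
  0 < u1 -> s < u1 ^+ 2 -> u1 <= u2 -> u2 <= v1 -> v1 <= v2 ->
  0 < 1 + alpha * v2 -> Phi s u2 - Phi s u1 = Phi s v2 - Phi s v1 ->
  log_ratio v1 - log_ratio v2 <= log_ratio u1 - log_ratio u2.
Proof.
move=> u1_gt0 su1 u12 uv v12 av e.
have u2_gt0 := lt_le_trans u1_gt0 u12.
have av1 := compr_gt0 v12 av; have au2 := compr_gt0 uv av1.
have M_gt0 : 0 < u2 ^+ 2 - s.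
  by rewrite subr_gt0 (subsonic_le u1_gt0 su1).
have hu := Phi_decr u1_gt0 (lexx _) u12 au2.
have hv : Phi (u2 ^+ 2) v1 <= Phi (u2 ^+ 2) v2.
  apply: Phi_le => //; first exact: lt_le_trans uv.
  by rewrite lerXn2r// nnegrE ltW// (lt_le_trans u2_gt0).
rewrite -(ler_pM2l M_gt0).
move: hu hv; rewrite !(Phi_shift s (u2 ^+ 2)); lra.
Qed.

(** * Dependence of a flow on its end pressures and on its flux *)

(** The gas flows from pressure hi to pressure lo; the inequality s < lo^2
says that the flow is subsonic, so that the larger end is subsonic too. *)
Definition flow k s hi lo : Prop :=
  [/\ 0 < lo, s < lo ^+ 2, lo <= hi, 0 < 1 + alpha * hi &
      Phi s hi = Phi s lo + k * s].

Lemma flow_le_hi k s hi lo hi' lo' :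
  flow k s hi lo -> flow k s hi' lo' -> lo <= lo' -> hi <= hi'.
Proof.
move=> [lo0 slo lohi ahi e] [lo0' slo' lohi' ahi' e'] ll.
rewrite leNgt; apply/negP => hh.
have : Phi s lo <= Phi s lo'.
  by apply: Phi_le => //; [exact: ltW|exact: compr_gt0 ahi'].
have : Phi s hi' < Phi s hi.
  apply: Phi_incr => //; first exact: lt_le_trans lohi'.
  by rewrite ltW// (subsonic_le lo0' slo').
lra.
Qed.

Lemma flow_le_lo k s hi lo hi' lo' :
  flow k s hi lo -> flow k s hi' lo' -> hi <= hi' -> lo <= lo'.
Proof.
move=> [lo0 slo lohi ahi e] [lo0' slo' lohi' ahi' e'] hh.
rewrite leNgt; apply/negP => ll.
have : Phi s lo' < Phi s lo.
  by apply: Phi_incr => //; first exact: ltW; exact: compr_gt0 ahi.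
have : Phi s hi <= Phi s hi'.
  apply: Phi_le => //; first exact: lt_le_trans lohi.
  by rewrite ltW// (subsonic_le lo0 slo).
lra.
Qed.

(** This is log_ratio_gap for the four end pressures. If the intervals
[lo, hi] and [lo', hi'] overlap, their common part is cancelled first: the
lemma is then applied to [lo, lo'] and [hi, hi']. *)
Lemma flow_gap k s hi lo hi' lo' :
  flow k s hi lo -> flow k s hi' lo' -> lo <= lo' ->
  log_ratio lo' - log_ratio hi' <= log_ratio lo - log_ratio hi.
Proof.
move=> f f' ll; have hh := flow_le_hi f f' ll.
move: f f' => [lo0 slo lohi ahi e] [lo0' slo' lohi' ahi' e'].
have [hl|lh] := leP hi lo'.
  by apply: (@log_ratio_gap s) => //; lra.
suff : log_ratio hi - log_ratio hi' <= log_ratio lo - log_ratio lo' by lra.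
by apply: (@log_ratio_gap s) => //; [exact: ltW|lra].
Qed.

(** At the larger parameter s' the required increment of Phi grows by
k (s' - s), whereas the available one, from lo' to hi, shrinks since log_ratio
decreases. *)
Lemma flow_lo_decr k s s' hi lo lo' : 0 <= k -> s <= s' ->
  flow k s hi lo -> flow k s' hi lo' -> lo' <= lo.
Proof.
move=> k0 ss [lo0 slo lohi ahi e] [lo0' slo' lohi' ahi' e'].
rewrite leNgt; apply/negP => ll.
have : Phi s lo < Phi s lo'.
  by apply: Phi_incr => //; [exact: ltW|exact: compr_gt0 ahi'].
have := log_ratio_decr lo0' lohi' ahi.
move: e'; rewrite !(Phi_shift s s'); nra.
Qed.

Lemma flow_hi_incr k s s' hi hi' lo : 0 <= k -> s <= s' ->
  flow k s hi lo -> flow k s' hi' lo -> hi <= hi'.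
Proof.
move=> k0 ss [lo0 slo lohi ahi e] [lo0' slo' lohi' ahi' e'].
rewrite leNgt; apply/negP => ll.
have : Phi s hi' < Phi s hi.
  apply: Phi_incr => //; first exact: lt_le_trans lohi'.
  rewrite ltW// (le_lt_trans ss)//; exact: subsonic_le lohi'.
have := log_ratio_decr lo0' lohi' ahi'.
move: e'; rewrite !(Phi_shift s s'); nra.
Qed.

(** * The factor 1 / Phi_s' *)
Definition inv_dPhi s q : R := q * (1 + alpha * q) / (q ^+ 2 - s).

Lemma inv_dPhi_gt0 s q :
  0 < q -> s < q ^+ 2 -> 0 < 1 + alpha * q -> 0 < inv_dPhi s q.
Proof. by move=> q0 sq aq; rewrite divr_gt0 ?mulr_gt0 ?subr_gt0. Qed.

(** Here 1 + alpha q decreases in q, while q / (q^2 - s) = 1 / (q - s / q)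
decreases in q and increases in s. *)
Lemma inv_dPhi_lt s s' q q' : 0 <= s' -> s' <= s -> s < q ^+ 2 -> 0 < q ->
  q < q' -> 0 < 1 + alpha * q' -> inv_dPhi s' q' < inv_dPhi s q.
Proof.
move=> s0 ss sq q0 qq aq'; have aq := compr_gt0 (ltW qq) aq'.
have q0' := lt_trans q0 qq.
have qq2 : q ^+ 2 < q' ^+ 2 by rewrite ltrXn2r// ltW.
rewrite /inv_dPhi ltr_pdivlMr ?subr_gt0// mulrAC ltr_pdivrMr; last by lra.
have aa : 1 + alpha * q' < 1 + alpha * q by rewrite ltrD2l ltr_nM2l.
have fac : q' * (q ^+ 2 - s) <= q * (q' ^+ 2 - s').
  have : s' * q <= s * q' by rewrite ler_pM// ltW.
  have : 0 < q * q' * (q' - q) by rewrite !mulr_gt0// subr_gt0.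
  lra.
have : 0 < q' * (q ^+ 2 - s) by rewrite mulr_gt0// subr_gt0.
nra.
Qed.

Lemma inv_dPhi_le s s' q q' : 0 <= s' -> s' <= s -> s < q ^+ 2 -> 0 < q ->
  q <= q' -> 0 < 1 + alpha * q' -> inv_dPhi s' q' <= inv_dPhi s q.
Proof.
move=> s0 ss sq q0; rewrite le_eqVlt => /predU1P[<- aq|qq aq']; last first.
  exact/ltW/inv_dPhi_lt.
rewrite ler_pM2l ?mulr_gt0// lef_pV2 ?posrE ?subr_gt0//.
  by rewrite lerB.
exact: le_lt_trans sq.
Qed.

(** * The outlet pressure *)
Context (Rs T theta L : R).
Context (Rs_gt0 : 0 < Rs) (T_gt0 : 0 < T) (theta_gt0 : 0 < theta).
Context (L_gt0 : 0 < L).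
Implicit Types chi : R.

Local Notation flux_sq chi := (chi ^+ 2 * Rs * T).
Local Notation k := (theta * L / 2).
Local Notation adm := (padm Rs T alpha).
Local Notation pv := (pv Rs T theta L alpha).

Let RsT_gt0 : 0 < Rs * T. Proof. exact: mulr_gt0. Qed.

Lemma padmP chi p :
  adm chi p <-> [/\ 0 < p, flux_sq chi < p ^+ 2 & 0 < 1 + alpha * p].
Proof.
have sqE : flux_sq chi = (`|chi| * Num.sqrt (Rs * T)) ^+ 2.
  by rewrite exprMn sqr_sqrtr ?ltW// real_normK ?num_real// mulrA.
have m0 : 0 <= `|chi| * Num.sqrt (Rs * T) by rewrite mulr_ge0.
rewrite /padm /= in_itv/= (ltr0_norm alpha_lt0).
rewrite ltr_pdivlMr ?oppr_gt0// mulrN sqE.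
split=> [/andP[mp ap]|[p0 mp ap]].
  have p0 : 0 < p by apply: le_lt_trans mp.
  by split; rewrite ?ltrXn2r// mulrC; lra.
apply/andP; split; last by lra.
by rewrite -(ltr_pXn2r (n:=2))// nnegrE ltW.
Qed.

Lemma FfunE chi p :
  0 < 1 + alpha * p -> Ffun Rs T alpha chi p = Phi (flux_sq chi) p.
Proof.
move=> ap; rewrite /Ffun gtr0_norm// /Phi /log_ratio; ring.
Qed.

(** The equation of the outlet pressure q for the inlet pressure p, which
determines q without reference to the partial inverse of F_chi. *)
Definition steady chi p q : Prop :=
  [/\ adm chi p, adm chi q &
      Phi (flux_sq chi) q =
        Phi (flux_sq chi) p - k * (Rs * T * (chi * `|chi|))].

Lemma Ffun_inj chi : {in adm chi &, injective (Ffun Rs T alpha chi)}.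
Proof.
move=> p q /set_mem/padmP[p0 sp ap] /set_mem/padmP[q0 sq' aq].
rewrite !FfunE//; have [pq|qp|//] := ltgtP p q => e.
- by have := Phi_incr p0 (ltW sp) pq aq; rewrite e ltxx.
- by have := Phi_incr q0 (ltW sq') qp ap; rewrite e ltxx.
Qed.

Lemma pv_eq chi p q : 0 < 1 + alpha * p -> adm chi q ->
  Phi (flux_sq chi) q = Phi (flux_sq chi) p - k * (Rs * T * (chi * `|chi|)) ->
  pv p chi = q.
Proof.
move=> ap admq e; have /padmP[_ _ aq] := admq.
rewrite /pv /pressure FfunE//.
set y := (X in Finv _ _ _ _ X).
have -> : y = Ffun Rs T alpha chi q by rewrite FfunE// e /y; field.
by rewrite /Finv pinvKV ?inE//; exact: Ffun_inj.
Qed.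

(** Outside the range of F_chi the partial inverse takes the value 0, which is
not admissible. *)
Lemma FinvK chi y : adm chi (Finv Rs T alpha chi y) ->
  Ffun Rs T alpha chi (Finv Rs T alpha chi y) = y.
Proof.
have [Iy _|nIy] := pselect ((Ffun Rs T alpha chi @` adm chi) y).
  by rewrite /Finv pinvK ?inE.
suff -> : Finv Rs T alpha chi y = 0 by move/padmP => []; rewrite ltxx.
rewrite /Finv /pinv_ splitV /=.
change (odflt 0 (if pselect ((Ffun Rs T alpha chi @` adm chi) y) is left Iy
  then Some (projT1 (cid2 Iy)) else None) = 0).
by case: pselect.
Qed.

Lemma pv_steady chi p : adm chi p -> adm chi (pv p chi) ->
  steady chi p (pv p chi).
Proof.
move=> admp admq; split=> //.
have /padmP[_ _ ap] := admp; have /padmP[q0 _ aq] := admq.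
by rewrite -FfunE// FinvK// FfunE//; field.
Qed.

Lemma steady_flow_ge0 chi p q : 0 <= chi -> steady chi p q ->
  flow k (flux_sq chi) p q.
Proof.
move=> chi0 [/padmP[p0 sp ap] /padmP[q0 sq' aq]].
rewrite ger0_norm// => e; split=> //; last by rewrite e; ring.
rewrite leNgt; apply/negP => pq.
have := Phi_incr p0 (ltW sp) pq aq.
rewrite e; apply/negP; rewrite -leNgt gerDl oppr_le0.
by rewrite !mulr_ge0// ltW.
Qed.

(** Reversing the flux exchanges inlet and outlet, because the friction term
is odd in chi while s is even. *)
Lemma steadyN chi p q : steady chi p q -> steady (- chi) q p.
Proof.
rewrite /steady /padm sqrrN !normrN => -[? ? e]; split=> //.
by rewrite e; ring.
Qed.

Lemma steady_flow_le0 chi p q : chi <= 0 -> steady chi p q ->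
  flow k (flux_sq chi) q p.
Proof.
move=> chi0 /steadyN st; rewrite -sqrrN; apply: steady_flow_ge0 st.
by rewrite oppr_ge0.
Qed.

(** Existence of the outlet pressure for the neighbouring fluxes, whether or
not they belong to the given range, together with its continuity. At chi0 the
defect W of the equation changes sign strictly between two admissible
pressures lo and hi within e of q0; as W is continuous in chi, it still does
for nearby chi, and the intermediate value theorem gives a solution there. *)
Lemma pv_near chi0 p q0 e : 0 < e -> steady chi0 p q0 ->
  \forall chi \near chi0,
    `|pv p chi - q0| <= e /\
    (adm chi (pv p chi) /\
     Phi (flux_sq chi) (pv p chi) =
       Phi (flux_sq chi) p - k * (Rs * T * (chi * `|chi|))).
Proof.
move=> e0 [/padmP[p0 _ ap] admq eq0].
have [lo [lo1 lo2 admlo]] : exists lo, [/\ q0 - e <= lo, lo < q0 & adm chi0 lo].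
  move: admq; rewrite /padm /= in_itv/=; set a := _ * _ => /andP[aq qb].
  (* a is the sonic bound; its midpoint with q0 keeps lo above it. *)
  exists (Num.max (q0 - e) ((a + q0) / 2)); split.
  - by rewrite le_max lexx.
  - rewrite gt_max; lra.
  - by rewrite in_itv/= lt_max gt_max; lra.
have [hi [hi1 hi2 admhi]] : exists hi, [/\ hi <= q0 + e, q0 < hi & adm chi0 hi].
  move: admq; rewrite /padm /= in_itv/=; set b := _ / `|alpha| => /andP[aq qb].
  (* b is the pressure at which 1 + alpha p vanishes. *)
  exists (Num.min (q0 + e) ((q0 + b) / 2)); split.
  - by rewrite ge_min lexx.
  - rewrite lt_min; lra.
  - by rewrite in_itv/= lt_min gt_min; lra.
have [q_gt0 sq0 aq0] := (padmP _ _).1 admq.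
have [lo_gt0 slo alo] := (padmP _ _).1 admlo.
have [hi_gt0 shi ahi] := (padmP _ _).1 admhi.
have csq : continuous (fun chi => flux_sq chi).
  move=> chi; apply: cvgM; last exact: cvg_cst.
  by apply: cvgM; [exact: exprn_continuous|exact: cvg_cst].
pose W x chi := Phi 0 x - Phi 0 p + flux_sq chi * (log_ratio x - log_ratio p)
  + k * (Rs * T * (chi * `|chi|)).
have cW x : continuous (W x).
  move=> chi; apply: cvgD.
    apply: cvgD; first exact: cvg_cst.
    by apply: cvgM; [exact: csq|exact: cvg_cst].
  apply: cvgM; first exact: cvg_cst.
  apply: cvgM; first exact: cvg_cst.
  by apply: cvgM; [exact: cvg_id|exact: norm_continuous].
have WE x chi : W x chi = Phi (flux_sq chi) x - Phi (flux_sq chi) p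
    + k * (Rs * T * (chi * `|chi|)).
  by rewrite /W !(Phi_shift 0 (flux_sq chi)); ring.
have Wlo : W lo chi0 < 0.
  have := Phi_incr lo_gt0 (ltW slo) lo2 aq0.
  rewrite WE eq0; lra.
have Whi : 0 < W hi chi0.
  have := Phi_incr q_gt0 (ltW sq0) hi2 ahi.
  rewrite WE eq0; lra.
near=> chi.
have slo' : flux_sq chi < lo ^+ 2 by near: chi; exact: (cvgr_lt _ (csq chi0)).
have Wlo' : W lo chi < 0 by near: chi; exact: (cvgr_lt _ (cW lo chi0)).
have Whi' : 0 < W hi chi by near: chi; exact: (cvgr_gt _ (cW hi chi0)).
have cPhi : {within `[lo, hi], continuous (Phi (flux_sq chi))}.
  apply: derivable_within_continuous => x; rewrite in_itv/= => /andP[lox xhi].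
  have [] // := is_derive_Phi (flux_sq chi) (lt_le_trans lo_gt0 lox)
    (compr_gt0 xhi ahi).
have [|q] := IVT (ltW (lt_trans lo2 hi2)) cPhi
    (v := Phi (flux_sq chi) p - k * (Rs * T * (chi * `|chi|))).
  by move: Wlo' Whi'; rewrite !WE ge_min le_max => *; apply/andP; split; lra.
rewrite in_itv/= => /andP[loq qhi] eqq.
have admq' : adm chi q.
  apply/padmP; split; [exact: lt_le_trans loq| |exact: compr_gt0 qhi ahi].
  exact: subsonic_le loq.
rewrite (pv_eq ap admq' eqq); split=> //.
by rewrite ler_norml; lra.
Unshelve. all: by end_near. Qed.

(** * The derivative in the flux *)

(** Gas flows towards the lower pressure, where log_ratio is larger. This is
what makes one formula for the derivative serve both flow directions. *)
Lemma norm_mul_log_ratio chi p q : steady chi p q ->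
  chi * (log_ratio q - log_ratio p) = `|chi| * `|log_ratio p - log_ratio q|.
Proof.
move=> st; have [chi0|/ltW chi0] := leP 0 chi.
  have [q0 _ qp ap _] := steady_flow_ge0 chi0 st.
  rewrite distrC !ger0_norm// subr_ge0; exact: log_ratio_decr.
have [p0 _ pq aq _] := steady_flow_le0 chi0 st.
rewrite ler0_norm// ger0_norm; first by ring.
by rewrite subr_ge0; exact: log_ratio_decr.
Qed.

(** The opposite of d_chi p_v at (p, chi), where q is the outlet pressure. *)
Definition slope chi p q : R :=
  2 * (Rs * T) * `|chi| * inv_dPhi (flux_sq chi) q
  * (`|log_ratio p - log_ratio q| + k).

(** Subtracting the equations of the outlet pressures at y and chi0 gives
Phi s0 (p_v p y) - Phi s0 q0 = (s - s0) (H p - H (p_v p y))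
- k Rs T (y |y| - chi0 |chi0|), where s0 and s belong to chi0 and y. Both terms
are divisible by y - chi0, so is_derive_implicit applies with P = Phi s0. *)
Lemma is_derive_pv chi0 p q0 : steady chi0 p q0 ->
  is_derive chi0 1 (pv p) (- slope chi0 p q0).
Proof.
move=> st.
have [/padmP[p_gt0 sp ap] admq0 eq0] := st.
have pvq : pv p chi0 = q0 by exact: pv_eq.
have [q_gt0 sq0 aq0] := (padmP _ _).1 admq0.
have cpv : {for chi0, continuous (pv p)}.
  apply/cvgrPdist_le => e e0; rewrite pvq.
  by apply: filterS (pv_near e0 st) => chi [+ _]; rewrite distrC.
have cH : {for pv p chi0, continuous log_ratio}.
  rewrite pvq; apply: cvgB; last exact: continuous_ln.
  apply: (@continuous_comp _ _ _ (fun x => 1 + alpha * x) (@ln R)).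
    apply: cvgD; first exact: cvg_cst.
    by apply: cvgM; [exact: cvg_cst|exact: cvg_id].
  exact: continuous_ln.
have /is_derive1_caratheodory[n [nE cn n0]] := is_derive_mul_norm chi0.
pose m y := - (Rs * T * ((y + chi0) * (log_ratio (pv p y) - log_ratio p)
  + k * n y)).
have := @is_derive_implicit R (Phi (flux_sq chi0)) (pv p) m chi0 _
  (is_derive_Phi (flux_sq chi0) _ _).
rewrite pvq => /(_ q_gt0 aq0) h.
apply: (is_derive_eq (h _ _ _ _)) => //.
- by rewrite gt_eqF// divr_gt0 ?mulr_gt0// subr_gt0.
- apply: cvgN; apply: cvgM; first exact: cvg_cst.
  apply: cvgD; last by apply: cvgM => //; exact: cvg_cst.
  apply: cvgM; first by apply: cvgD; [exact: cvg_id|exact: cvg_cst].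
  apply: cvgB; last exact: cvg_cst.
  exact: (@continuous_comp _ _ _ (pv p) log_ratio).
- apply: filterS (pv_near ltr01 st) => y [_ [_ ey]].
  move: ey; rewrite !(Phi_shift (flux_sq chi0) (flux_sq y)) => ey.
  have -> : m y * (y - chi0) = - (Rs * T * ((y + chi0) * (y - chi0)
      * (log_ratio (pv p y) - log_ratio p) + k * (n y * (y - chi0)))).
    by rewrite /m; ring.
  by rewrite -nE; move: ey eq0; lra.
- rewrite /m n0 pvq /slope /inv_dPhi invf_div.
  have -> : (chi0 + chi0) * (log_ratio q0 - log_ratio p)
      = 2 * (`|chi0| * `|log_ratio p - log_ratio q0|).
    by rewrite -norm_mul_log_ratio//; ring.
  ring.
Qed.

(** * Comparison of derivatives *)
Let k_ge0 : 0 <= k. Proof. by rewrite divr_ge0// mulr_ge0// ltW. Qed.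

Let flux_sq_ge0 chi : 0 <= flux_sq chi.
Proof. by rewrite -mulrA mulr_ge0 ?sqr_ge0// ltW. Qed.

Lemma flux_sq_le chi chi' : `|chi| <= `|chi'| -> flux_sq chi <= flux_sq chi'.
Proof.
move=> cc; rewrite -!(mulrA (_ ^+ 2)); apply: ler_wpM2r; first exact: ltW.
rewrite -(real_normK (num_real chi)) -(real_normK (num_real chi')).
by rewrite lerXn2r// nnegrE.
Qed.

Lemma slope_ge0 chi p q : steady chi p q -> 0 <= slope chi p q.
Proof.
move=> [_ /padmP[q0 sq0 aq] _].
rewrite mulr_ge0 ?addr_ge0// mulr_ge0 ?(ltW (inv_dPhi_gt0 _ _ _))//.
by rewrite !mulr_ge0// ltW.
Qed.

Lemma slope_le chi chi' p p' q q' :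
  `|chi| <= `|chi'| ->
  0 <= inv_dPhi (flux_sq chi) q <= inv_dPhi (flux_sq chi') q' ->
  `|log_ratio p - log_ratio q| <= `|log_ratio p' - log_ratio q'| ->
  slope chi p q <= slope chi' p' q'.
Proof.
move=> cc /andP[e0 ee] gg; have R0 := ltW RsT_gt0.
have c0 : 0 <= 2 * (Rs * T) * `|chi| by apply: mulr_ge0 => //; apply: mulr_ge0.
apply: ler_pM; [exact: mulr_ge0|exact: addr_ge0| |by rewrite lerD2r].
by apply: ler_pM => //; apply: ler_wpM2l => //; exact: mulr_ge0.
Qed.

(** The pressures are compared in two moves, through the pipe with inlet p' and
flux chi, whose outlet pressure is q1: from p to p' at the flux chi the whole
flow drops (flow_gap), then from chi to chi' only the outlet drops. *)
Lemma slope_le_ge0 chi chi' p p' q q' q1 :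
  0 <= chi -> chi <= chi' -> p' <= p ->
  steady chi p q -> steady chi p' q1 -> steady chi' p' q' ->
  slope chi p q <= slope chi' p' q'.
Proof.
move=> chi0 cc pp st st1 st'; have chi0' := le_trans chi0 cc.
have ncc : `|chi| <= `|chi'| by rewrite !ger0_norm.
have ss := flux_sq_le ncc.
have f := steady_flow_ge0 chi0 st.
have f1 := steady_flow_ge0 chi0 st1.
have f' := steady_flow_ge0 chi0' st'.
have q1q := flow_le_lo f1 f pp.
have q'q1 := flow_lo_decr k_ge0 ss f1 f'.
have gap := flow_gap f1 f q1q.
case: f f1 f' => [q0 sq0 qp ap _] [q10 _ qp1 _ _] [q'0 sq'0 qp' ap' _].
have aq := compr_gt0 qp ap.
apply: slope_le => //.
  rewrite ltW ?inv_dPhi_gt0//= inv_dPhi_le//; exact: le_trans q1q.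
have hq := log_ratio_decr q'0 q'q1 (compr_gt0 qp1 ap').
have hqp := log_ratio_decr q0 qp ap.
have hqp' := log_ratio_decr q'0 qp' ap'.
by rewrite !ler0_norm ?subr_le0//; lra.
Qed.

(** For gas entering at the far end, the inlet pressure p is the lower end of
the flow; raising it raises q and narrows the gap. The flux is kept fixed: as
|chi| grows, both s and q grow, with opposite effects on 1 / Phi_s'(q). *)
Lemma slope_le_le0 chi p p' q q' :
  chi <= 0 -> p' <= p -> steady chi p q -> steady chi p' q' ->
  slope chi p q <= slope chi p' q'.
Proof.
move=> chi0 pp st st'.
have f := steady_flow_le0 chi0 st.
have f' := steady_flow_le0 chi0 st'.
have qq := flow_le_hi f' f pp.
have gap := flow_gap f' f pp.
case: f f' => [p0 sp pq aq _] [p0' sp' pq' aq' _].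
have q0 := lt_le_trans p0 pq; have q0' := lt_le_trans p0' pq'.
apply: slope_le => //.
  have sq := subsonic_le p0 sp pq; have sq' := subsonic_le p0' sp' pq'.
  by rewrite ltW ?inv_dPhi_gt0 ?inv_dPhi_le.
have hpq := log_ratio_decr p0 pq aq.
have hpq' := log_ratio_decr p0' pq' aq'.
by rewrite !ger0_norm ?subr_ge0.
Qed.

(** On the right the pipe is reversed: it carries the flow from q' to p, so its
outlet is the lower end p. If chi < 0, then p < q makes the factor inv_dPhi
strictly larger there; if chi = 0, the left side vanishes and the right side
is positive. *)
Lemma slope_lt_rev chi chi' p q q' :
  chi' <= chi -> chi <= 0 -> chi' < 0 ->
  steady chi p q -> steady chi' p q' ->
  slope chi p q < slope (- chi') q' p.
Proof.
move=> cc chi_le0 chi'_lt0 st st'.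
have k_gt0 : 0 < k by rewrite divr_gt0// mulr_gt0.
have f := steady_flow_le0 chi_le0 st.
have f' := steady_flow_le0 (ltW chi'_lt0) st'.
have ss : flux_sq chi <= flux_sq chi'.
  by apply: flux_sq_le; rewrite !ler0_norm ?lerN2// ltW.
have qq := flow_hi_incr k_ge0 ss f f'.
case: f f' => [p0 sp pq aq e] [_ sp' pq' aq' _].
have ap := compr_gt0 pq aq; have q0 := lt_le_trans p0 pq.
have rhs_gt0 : 0 < slope (- chi') q' p.
  rewrite /slope mulr_gt0 ?ltr_wpDl// mulr_gt0 ?inv_dPhi_gt0 ?sqrrN//.
  by rewrite !mulr_gt0// normrN normr_gt0 lt_eqF.
move: chi_le0; rewrite le_eqVlt => /predU1P[chi0|chi_lt0].
  by have -> : slope chi p q = 0 by rewrite /slope chi0 normr0 mulr0 !mul0r.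
have s_gt0 : 0 < flux_sq chi.
  by rewrite -mulrA mulr_gt0// lt_neqAle sqr_ge0 andbT eq_sym sqrf_eq0 lt_eqF.
have {}pq : p < q.
  move: pq; rewrite le_eqVlt => /predU1P[pq|//].
  by have := mulr_gt0 k_gt0 s_gt0; rewrite pq in e; lra.
have hpq := log_ratio_decr p0 (ltW pq) aq.
have hqq := log_ratio_decr q0 qq aq'.
rewrite /slope sqrrN normrN.
(* First move the factor inv_dPhi from (s, q) to (s', p), which is where
   strictness comes from; then increase the flux and widen the gap. *)
apply: (@lt_le_trans _ _ (2 * (Rs * T) * `|chi| * inv_dPhi (flux_sq chi') p
  * (`|log_ratio p - log_ratio q| + k))).
  rewrite ltr_pM2r ?ltr_wpDl// ltr_pM2l ?inv_dPhi_lt//.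
  by rewrite !mulr_gt0// normr_gt0 lt_eqF.
have inv_dPhi0 := inv_dPhi_gt0 p0 sp' ap; have R0 := ltW RsT_gt0.
apply: ler_pM.
- by apply: mulr_ge0; [apply: mulr_ge0 => //; apply: mulr_ge0|exact: ltW].
- by rewrite addr_ge0.
- rewrite ler_pM2r// (ler_wpM2l (mulr_ge0 (ler0n _ 2) R0))//.
  by rewrite !ltr0_norm ?lerN2.
- by rewrite lerD2r distrC !ler0_norm ?subr_le0//; lra.
Qed.

Lemma slope_continuous chi p : steady chi p (pv p chi) ->
  {for chi, continuous (fun x => slope x p (pv p x))}.
Proof.
move=> st; have [_ /padmP[q0 sq0 aq] _] := st.
have cpv : {for chi, continuous (pv p)}.
  apply/differentiable_continuous/derivable1_diffP.
  by have [] := is_derive_pv st.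
have cn : {for chi, continuous (fun x : R => `|x|)} by exact: norm_continuous.
have cap : {for chi, continuous (fun x => 1 + alpha * pv p x)}.
  by apply: cvgD; [exact: cvg_cst|apply: cvgM => //; exact: cvg_cst].
have cH : {for chi, continuous (fun x => log_ratio (pv p x))}.
  apply: cvgB.
    by apply: (@continuous_comp _ _ _ _ (@ln R)) cap _; exact: continuous_ln.
  by apply: (@continuous_comp _ _ _ _ (@ln R)) cpv _; exact: continuous_ln.
apply: cvgM.
  apply: cvgM; first by apply: cvgM => //; exact: cvg_cst.
  apply: cvgM; first exact: cvgM.
  apply: cvgV; first by rewrite gt_eqF// subr_gt0.
  apply: cvgB; first exact: cvgM.
  apply: cvgM; last exact: cvg_cst.
  by apply: cvgM; [exact: exprn_continuous|exact: cvg_cst].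
apply: cvgD; last exact: cvg_cst.
by apply: cvg_norm; apply: cvgB => //; exact: cvg_cst.
Qed.

End Pipe.

Theorem theorem5p5 (R : realType) (Rs T theta L alpha : R)
    (Rs_gt0 : 0 < Rs) (T_gt0 : 0 < T) (theta_gt0 : 0 < theta) (L_gt0 : 0 < L)
    (alpha_lt0 : alpha < 0)
    (pu_lo pu_hi chi_lo chi_hi : R)
    (pu_lohi : pu_lo <= pu_hi) (chi_lohi : chi_lo <= chi_hi)
    (pu_adm : forall chi : R, chi_lo <= chi <= chi_hi ->
       [set` `[pu_lo, pu_hi]] `<=` padm Rs T alpha chi)
    (pv_adm : forall pu chi : R,
       pu_lo <= pu <= pu_hi -> chi_lo <= chi <= chi_hi ->
       padm Rs T alpha chi (pv Rs T theta L alpha pu chi))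
    (pm pp chim chip : R)
    (box_neq0 : [set` `[pm, pp]] `*` [set` `[chim, chip]] !=set0)
    (box_sub : [set` `[pm, pp]] `*` [set` `[chim, chip]] `<=`
       [set` `[pu_lo, pu_hi]] `*` [set` `[chi_lo, chi_hi]]) :
  let F := [set` `[pm, pp]] `*` [set` `[chim, chip]] in
  let dpv := dchi_pv Rs T theta L alpha in
  [/\ (forall pu chi : R,
         pu_lo <= pu <= pu_hi -> chi_lo <= chi <= chi_hi ->
         derivable (pv Rs T theta L alpha pu) chi 1 /\ dpv pu chi <= 0),
      (0 <= chip ->
         is_minimum
           ((fun z : R * R => dpv z.1 z.2) @`
              (F `&` ([set: R] `*` [set` `[0, +oo[])))
           (dpv pm chip)) &
      (chim < 0 ->
         derivable (pv Rs T theta L alpha (pv Rs T theta L alpha pm chim))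
           (- chim) 1 /\
         exists m : R,
           is_minimum
             ((fun z : R * R => dpv z.1 z.2) @`
                (F `&` ([set: R] `*` [set` `]-oo, 0]]))) m /\
           dpv (pv Rs T theta L alpha pm chim) (- chim) < m)].
Proof.
move=> F dpv.
have [pm_le_pp chim_le_chip] : pm <= pp /\ chim <= chip.
  case: box_neq0 => -[p chi] [/=].
  rewrite !in_itv/= => /andP[h1 h2] /andP[h3 h4].
  by split; [exact: le_trans h2|exact: le_trans h4].
have st p chi : pu_lo <= p <= pu_hi -> chi_lo <= chi <= chi_hi ->
    steady alpha Rs T theta L chi p (pv Rs T theta L alpha p chi).
  move=> hp hchi; apply: pv_steady => //; last exact: pv_adm.
  by apply: pu_adm; rewrite //= in_itv.
have dst p q chi : steady alpha Rs T theta L chi p q ->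
    derivable (pv Rs T theta L alpha p) chi 1 /\
    dpv p chi = - slope alpha Rs T theta L chi p q.
  move=> /is_derive_pv[]// dp e; split=> //.
  by rewrite /dpv /dchi_pv derive1E.
have box p chi : pm <= p <= pp -> chim <= chi <= chip ->
    steady alpha Rs T theta L chi p (pv Rs T theta L alpha p chi).
  move=> hp hchi; have [] := box_sub (p, chi).
    by split; rewrite /= in_itv.
  by rewrite /= !in_itv/=; exact: st.
have pm_box : pm <= pm <= pp by rewrite lexx.
split.
- move=> p chi hp hchi; have s := st _ _ hp hchi.
  have [dp ->] := dst _ _ _ s; split=> //.
  by rewrite oppr_le0; exact: slope_ge0.
- move=> chip0; have chip_box : chim <= chip <= chip by rewrite lexx andbT.
  split.
    exists (pm, chip) => //; split; last by split; rewrite //= in_itv/= andbT.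
    by split; rewrite /= in_itv.
  move=> _ [[p chi] [[/= hp hchi] [_ /= chi0]] <-].
  move: hp hchi chi0; rewrite !in_itv/= andbT => hp hchi chi0.
  have [pmp _] := andP hp; have [_ cc] := andP hchi.
  rewrite (dst _ _ _ (box _ _ hp hchi)).2.
  rewrite (dst _ _ _ (box _ _ pm_box chip_box)).2.
  rewrite lerN2.
  by apply: slope_le_ge0 (box _ _ _ _) (box _ _ _ _) (box _ _ _ _).
- move=> chim_lt0; have chim_box : chim <= chim <= chip by rewrite lexx.
  have stm := box _ _ pm_box chim_box.
  have stN := steadyN stm.
  have [dN eN] := dst _ _ _ stN; split=> //.
  (* The part of the box where chi <= 0 is [pm, pp] x [chim, top]. *)
  set top := Num.min chip 0.
  have chim_top : chim <= top by rewrite le_min chim_le_chip ltW.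
  have top_box chi : chim <= chi <= top -> chim <= chi <= chip /\ chi <= 0.
    by rewrite le_min => /and3P[-> -> ->].
  have [|c] := @EVT_min R (fun x => - slope alpha Rs T theta L x pm
      (pv Rs T theta L alpha pm x)) _ _ chim_top.
    apply: continuous_in_subspaceT => x /set_mem/=; rewrite in_itv/= => hx.
    apply: cvgN; apply: slope_continuous => //; apply: box => //.
    by case: (top_box _ hx).
  rewrite in_itv/= => hc minc; have [c_box c_le0] := top_box _ hc.
  have [_ ec] := dst _ _ _ (box _ _ pm_box c_box).
  exists (dpv pm c); split; [split|].
  + by exists (pm, c).
  + move=> _ [[p chi] [[/= hp hchi] [_ /= chi0]] <-].
    move: hp hchi chi0; rewrite !in_itv/= => hp hchi chi0.
    have [pmp _] := andP hp; have [cc1 cc2] := andP hchi.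
    rewrite (dst _ _ _ (box _ _ hp hchi)).2 ec.
    apply: (@le_trans _ _ (- slope alpha Rs T theta L chi pm
      (pv Rs T theta L alpha pm chi))).
      by apply: minc; rewrite in_itv/= cc1 le_min cc2.
    by rewrite lerN2; apply: slope_le_le0 (box _ _ _ _) (box _ _ _ _).
  + rewrite eN ec ltrN2.
    by apply: slope_lt_rev => //; [case/andP: c_box|exact: box].
Qed.
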